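(* For $n\ge 2$ let $S=\{1,2,\dots,n\}$ and let $P_n=(p_{i,j})$ be the stochastic matrix on $S$ with $p_{i,j}=n^{-1}$ for all $i,j\in S$. For every $n\ge 2$ and every integer $l\geq 1$, there exists a block measure $\mu\in\mathcal L(P_n)$ with $k(\mu)=l$ if and only if $l\mid n$. In particular, $K(P_n)\supseteq\{l: l\mid n\}$. Furthermore, for $n\ge 3$, we have $n-1\notin K(P_n)$.
   Context: $\mathcal F_S$ is the set of all functions from $S$ to $S$; $\mathbb N=\{1,2,\dots\}$. For an irreducible stochastic matrix $P=(p_{i,j}:i,j\in S)$, $\mathcal L(P)$ is the set of probability measures $\mu$ on $\mathcal F_S$ that are consistent with $P$, i.e. $p_{i,j}=\mu(\{f\in\mathcal F_S:f(i)=j\})$ for all $i,j\in S$. $\operatorname{supp}(\mu)$ is the support of $\mu$. Coalescence number: let $F=(F_s:s\in\mathbb N)$ be independent random functions each with law $\mu$, let $\boldsymbol\mu=\prod_{i\in\mathbb N}\mu$ be the law of $F$, and let $\vec F_t=F_t\circ F_{t-1}\circ\cdots\circ F_1$. Define the equivalence relation $\sim$ on $S$ by $i\sim j$ if and only if $\vec F_t(i)=\vec F_t(j)$ for some $t\in\mathbb N$, and let $k(F)$ be the number of equivalence classes of $\sim$. It is known that $k(F)$ is $\boldsymbol\mu$-a.s. constant; the coalescence number $k(\mu)$ is this almost surely constant value. Finally, $K(P)=\{k:\text{there exists }\mu\in\mathcal L(P)\text{ with }k(\mu)=k\}$. Block measure: for a partition $\mathcal S=\{S_r:r=1,2,\dots,l\}$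 of $S$ into non-empty sets, with $l\ge1$, a measure $\mu\in\mathcal L(P)$ is an $\mathcal S$-block measure if (i) for each $f\in\operatorname{supp}(\mu)$ there exists a unique permutation $\pi=\pi_f$ of $\{1,2,\dots,l\}$ such that $f(S_r)\subseteq S_{\pi(r)}$ for all $r\in\{1,\dots,l\}$, and (ii) $k(\mu)=l$. A block measure is an $\mathcal S$-block measure for some partition $\mathcal S$ of $S$. *)

(* Defs.v *)
From HB Require Import structures.
From mathcomp Require Import all_boot all_order all_algebra all_fingroup.
From mathcomp Require Import all_classical all_reals all_analysis.
Set Implicit Arguments.
Unset Strict Implicit.
Unset Printing Implicit Defensive.
Import Order.TTheory GRing.Theory Num.Theory.
Local Open Scope classical_set_scope.
Local Open Scope ring_scope.

(* The functions from S = 'I_n to itself, with the discrete sigma-algebra (an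
   alias, so that the instances below do not leak to all finite functions). *)
Definition selfmap (n : nat) := {ffun 'I_n -> 'I_n}.

HB.instance Definition _ (n : nat) := Finite.on (selfmap n).
HB.instance Definition _ (n : nat) := isPointed.Build (selfmap n) [ffun i => i].
HB.instance Definition _ (n : nat) :=
  @isMeasurable.Build default_measure_display (selfmap n)
    discrete_measurable discrete_measurable0
    discrete_measurableC discrete_measurableU.

(* Sequences are indexed from 0: the s-th random function, s = 1, 2, ..., is
   [F s.-1]. They carry the sigma-algebra generated by the coordinates. *)
Definition coordinate_events (n : nat) : set (set (nat -> selfmap n)) :=
  \bigcup_(s in [set: nat])
    preimage_set_system setT (fun F : nat -> selfmap n => F s) measurable.

Definition mapseq (n : nat) := g_sigma_algebraType (@coordinate_events n).

(* [M] is the law of a sequence of independent functions of law [mu], i.e. the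
   infinite product of copies of [mu], characterized by its values on
   cylinders. *)
Definition is_product_law (R : realType) (n : nat)
    (mu : probability (selfmap n) R) (M : probability (mapseq n) R) : Prop :=
  forall (N : nat) (A : nat -> set (selfmap n)),
    M [set F : mapseq n | forall s, (s < N)%N -> A s (F s)] =
    (\prod_(s < N) mu (A s))%E.

(* F_t o ... o F_1 *)
Fixpoint forward (n : nat) (F : nat -> selfmap n) (t : nat) (i : 'I_n) : 'I_n :=
  if t is u.+1 then F u (forward F u i) else i.

Definition coalesce (n : nat) (F : nat -> selfmap n) : rel 'I_n :=
  fun i j => `[< exists t, (1 <= t)%N /\ forward F t i = forward F t j >].

Definition nb_classes (n : nat) (F : nat -> selfmap n) : nat :=
  #|equivalence_partition (coalesce F) [set: 'I_n]%SET|.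

(* [is_coalescence_number mu k] reads "k(mu) = k"; both the product law and
   the almost sure value of [nb_classes] exist and are unique. *)
Definition is_coalescence_number (R : realType) (n : nat)
    (mu : probability (selfmap n) R) (k : nat) : Prop :=
  exists M : probability (mapseq n) R,
    is_product_law mu M /\ {ae M, forall F : mapseq n, nb_classes F = k}.

Definition consistent (R : realType) (n : nat) (P : 'M[R]_n) :
    set (probability (selfmap n) R) :=
  [set mu : probability (selfmap n) R |
    forall i j, (P i j)%:E = mu [set f : selfmap n | f i = j]].

Definition coalescence_numbers (R : realType) (n : nat) (P : 'M[R]_n) :
    set nat :=
  [set k | exists2 mu : probability (selfmap n) R,
    consistent P mu & is_coalescence_number mu k].

Definition supp (R : realType) (n : nat) (mu : probability (selfmap n) R) :
    set (selfmap n) :=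
  [set f | (0 < mu [set f])%E].

(* Injectivity makes the (non-empty) blocks B r pairwise disjoint. *)
Definition is_partition_family (n l : nat) (B : 'I_l -> {set 'I_n}) : Prop :=
  injective B /\ finset.partition [set B r | r : 'I_l]%SET [set: 'I_n]%SET.

Definition is_block_measure_for (R : realType) (n : nat) (P : 'M[R]_n)
    (l : nat) (B : 'I_l -> {set 'I_n}) (mu : probability (selfmap n) R) : Prop :=
  [/\ consistent P mu,
      forall f, supp mu f -> exists! p : {perm 'I_l},
        forall r, (f : {ffun 'I_n -> 'I_n}) @: B r \subset B (p r)
    & is_coalescence_number mu l].

Definition is_block_measure (R : realType) (n : nat) (P : 'M[R]_n)
    (mu : probability (selfmap n) R) : Prop :=
  exists (l : nat) (B : 'I_l -> {set 'I_n}),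
    [/\ (1 <= l)%N, is_partition_family B & is_block_measure_for P B mu].

Definition uniform_mx (R : realType) (n : nat) : 'M[R]_n :=
  const_mx (n%:R^-1).

(* Main.v *)
From HB Require Import structures.
Require Import Defs.
From mathcomp Require Import all_boot all_order all_algebra all_fingroup.
From mathcomp Require Import all_classical all_reals all_analysis.
Set Implicit Arguments.
Unset Strict Implicit.
Unset Printing Implicit Defensive.
Import Order.TTheory GRing.Theory Num.Theory.

(** The obstructions come from two averages, which hold because P_n is uniform: the
    image of a point is uniform on S, and the fibre over a point has mean size 1.

    If mu is a block measure with l blocks, choose one point in each block. Exactly
    one of these l points is mapped into a given block B, and each of them is
    mapped there with probability |B| / n; so l |B| = n and l divides n
    (block_dvdn). To conclude from the hypothesis that the coalescence number is l,
    one needs that it is unique (coalescence_number_unique); this holds because the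
    product law is determined by its values on cylinders.

    If l divides n, identify S with the pairs of a residue modulo l and a quotient.
    A uniform point a = c + l d of S defines the map that shifts the residues by c
    and replaces all the quotients by d (shift_map). The image of every point is
    uniform, the residue classes are permuted, and after one step trajectories with
    the same residue have merged while the others never do; so there are exactly l
    classes for every sequence of such maps. The infinite product law of this
    measure is realized by the base n digits of a point of the unit interval under
    Lebesgue measure: they are independent and uniform (lebesgue_digit_event).

    If the coalescence number were n - 1, then every composition of three maps of
    the support would have rank at least n - 1, since such a composition occurs
    first with positive probability (coalescence_le_word). Together with the mean
    fibre size this makes every map of the support injective (no_corank1), and
    then no two trajectories ever merge, so that the number of classes is n. *)

(** * Coalescence classes and ranks of compositions *)

(** C factors as g o h, so that g maps the image of h onto that of C. *)
Lemma leq_card_imset_factor (T U V : finType) (C : T -> U) (h : T -> V) :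
  (forall x y, h x = h y -> C x = C y) ->
  #|[set C x | x : T]%SET| <= #|[set h x | x : T]%SET|.
Proof.
move=> hC; pose g v := omap C [pick x | h x == v].
have SI : injective (@Some U) by move=> ? ? [].
rewrite -(card_imset _ SI).
apply: leq_trans (leq_imset_card g _); apply: subset_leq_card.
apply/fintype.subsetP => _ /imsetP[_ /imsetP[x _ ->] ->]; apply/imsetP; exists (h x).
  exact: imset_f.
rewrite /g; case: pickP => [y /eqP /hC e|/(_ x)]; first by rewrite /= e.
by rewrite eqxx.
Qed.

Lemma forward_merge n (F : nat -> selfmap n) s t i j :
  s <= t -> forward F s i = forward F s j -> forward F t i = forward F t j.
Proof.
move=> /subnK <- e; elim: (t - s) => [|u IH] //.
by rewrite addSn /= IH.
Qed.

(** Two trajectories that have met stay together, so coalescence is transitive;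
    equality of the classes, seen as functions, is the form used for counting. *)
Lemma coalesce_eq n (F : nat -> selfmap n) i j :
  coalesce F i j -> coalesce F i =1 coalesce F j.
Proof.
move=> /asboolP[t [t1 e]] k; apply/asboolP/asboolP => -[u [u1 e']];
  exists (maxn t u); (split; first by rewrite leq_max t1);
  rewrite -(forward_merge (leq_maxr t u) e');
  by rewrite (forward_merge (leq_maxl t u) e).
Qed.

Lemma nb_classesE n (F : nat -> selfmap n) (V : finType) (h : 'I_n -> V) :
  (forall i j, coalesce F i j <-> h i = h j) ->
  nb_classes F = #|[set h i | i : 'I_n]%SET|.
Proof.
move=> H; apply/eqP; rewrite eqn_leq /nb_classes /equivalence_partition.
have E : [set [set y in [set: 'I_n]%SET | coalesce F x y]%SET | x in [set: 'I_n]%SET]%SET =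
  [set [set y in [set: 'I_n]%SET | coalesce F x y]%SET | x : 'I_n]%SET.
  by apply/setP => z; apply/imsetP/imsetP => -[x _ ->]; exists x.
rewrite E; apply/andP; split; apply: leq_card_imset_factor => x y.
  by move=> /H /coalesce_eq e; apply/setP => z; rewrite !inE e.
move=> /setP /(_ y); rewrite !inE /= => e; apply/H; rewrite e.
by apply/H.
Qed.

(** Points with the same image at time t coalesce, so the number of classes is
    at most the rank of the composition of the first t maps. *)
Lemma nb_classes_le n (F : nat -> selfmap n) t :
  0 < t -> nb_classes F <= #|[set forward F t i | i : 'I_n]%SET|.
Proof.
move=> t0; rewrite /nb_classes /equivalence_partition.
apply: leq_trans (leq_card_imset_factor (C := fun x : 'I_n =>
  [set y in [set: 'I_n]%SET | coalesce F x y]%SET) _); last first.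
  move=> x y e; apply/setP => z; rewrite !inE (@coalesce_eq _ F x y) //.
  by apply/asboolP; exists t.
by apply/subset_leq_card/imsetS/fintype.subsetP.
Qed.

Lemma nb_classes_injective n (F : nat -> selfmap n) :
  (forall s, injective (F s)) -> nb_classes F = n.
Proof.
move=> Finj; rewrite (@nb_classesE _ _ _ id); last first.
  move=> i j; split=> [/asboolP[t [_]]|->].
    by elim: t => //= t IH /Finj.
  by apply/asboolP; exists 1%N.
by rewrite (card_imset _ (@inj_id _)) card_ord.
Qed.

(** If f o g collapses at most one pair of points, then the image of g is all of
    S except c, and f is injective on it; so every pair that f identifies
    involves the missing point c. *)
Lemma missing_in_kernel n (f g : 'I_n -> 'I_n) (a b c : 'I_n) :
  n.-1 <= #|[set f (g i) | i : 'I_n]%SET| ->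
  (forall i, g i != c) -> a != b -> f a = f b -> (c == a) || (c == b).
Proof.
move=> rk gc ab fab; apply: contraLR rk; rewrite negb_or => /andP[ca cb].
rewrite -ltnNge.
have sub : [set f (g i) | i : 'I_n]%SET \subset
    [set f i | i in [set~ c] :\ b]%SET.
  apply/fintype.subsetP => _ /imsetP[i _ ->]; apply/imsetP.
  have [gb|gb] := eqVneq (g i) b.
    by exists a; rewrite ?gb // !inE ab (eq_sym a) ca.
  by exists (g i); rewrite // !inE gb gc.
apply: leq_ltn_trans (subset_leq_card sub) _.
apply: leq_ltn_trans (leq_imset_card _ _) _.
have := cardsC1 c; rewrite card_ord => <-.
by rewrite [X in _ < X](cardsD1 b) !inE (eq_sym b) cb.
Qed.

(** * Finite averages over uniformly distributed images *)

Local Open Scope ring_scope.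

Definition fibre n (f : selfmap n) (j : 'I_n) : {set 'I_n} :=
  [set i | f i == j]%SET.

(** The law of the random map is seen only through the weights of single maps.
    The sum condition says that the image of any given point is uniform. *)
Section UniformWeights.
Variables (R : realType) (n : nat) (w : selfmap n -> R).
Hypothesis n_gt0 : (0 < n)%N.
Hypothesis w_ge0 : forall f, 0 <= w f.
Hypothesis w_marginal : forall i j, \sum_f w f * (f i == j)%:R = n%:R^-1.

Lemma sum_weights : \sum_f w f = 1.
Proof.
have nR : (n%:R : R) != 0 by rewrite pnatr_eq0 -lt0n.
pose i := Ordinal n_gt0.
transitivity (\sum_j \sum_f w f * (f i == j)%:R); last first.
  under eq_bigr do rewrite w_marginal.
  by rewrite sumr_const card_ord -[LHS]mulr_natr mulVf.
rewrite exchange_big /=; apply: eq_bigr => f _.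
rewrite -mulr_sumr (bigD1 (f i)) //= eqxx big1 ?addr0 ?mulr1 // => j.
by rewrite eq_sym => /negPf ->.
Qed.

(** Double counting: a uniform transition matrix is doubly stochastic, so a random
    fibre has mean size 1. *)
Lemma mean_fibre j : \sum_f w f * (#|fibre f j|%:R : R) = 1.
Proof.
have nR : (n%:R : R) != 0 by rewrite pnatr_eq0 -lt0n.
transitivity (\sum_i \sum_f w f * (f i == j)%:R); last first.
  under eq_bigr do rewrite w_marginal.
  by rewrite sumr_const card_ord -[LHS]mulr_natr mulVf.
rewrite exchange_big /=; apply: eq_bigr => f _.
rewrite -mulr_sumr -natr_sum -sum1_card big_mkcond /=.
by congr (_ * _%:R); apply: eq_bigr => i _; rewrite inE; case: eqP.
Qed.

(** A random integer that is at least 1 and has mean 1 is equal to 1. *)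
Lemma fibre_eq1 j : (forall f, 0 < w f -> (0 < #|fibre f j|)%N) ->
  forall f, 0 < w f -> #|fibre f j| = 1%N.
Proof.
move=> hit f wf.
have E : \sum_f w f * (#|fibre f j|%:R - 1) = 0 :> R.
  under eq_bigr do rewrite mulrBr mulr1.
  by rewrite sumrB mean_fibre sum_weights subrr.
have pos g : true -> 0 <= w g * (#|fibre g j|%:R - 1).
  move=> _; have [->|wg] := eqVneq (w g) 0; first by rewrite mul0r.
  by rewrite mulr_ge0 // subr_ge0 ler1n hit // lt_neqAle eq_sym wg w_ge0.
have /(_ f isT) /eqP := psumr_eq0P pos E.
by rewrite mulf_eq0 gt_eqF //= subr_eq0 pnatr_eq1 => /eqP.
Qed.

(** The mean 1 has to make up for the empty fibre of f0. *)
Lemma fibre_ge2 j f0 : 0 < w f0 -> #|fibre f0 j| = 0%N ->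
  exists2 f, 0 < w f & (1 < #|fibre f j|)%N.
Proof.
move=> wf0 f0j; apply: contrapT => /forall2NP none.
have E : \sum_f w f * (1 - #|fibre f j|%:R) = 0 :> R.
  under eq_bigr do rewrite mulrBr mulr1.
  by rewrite sumrB mean_fibre sum_weights subrr.
have pos g : true -> 0 <= w g * (1 - #|fibre g j|%:R).
  move=> _; have [->|wg] := eqVneq (w g) 0; first by rewrite mul0r.
  rewrite mulr_ge0 // subr_ge0 lern1 leqNgt; apply/negP.
  by have [[]|//] := none g; rewrite lt_neqAle eq_sym wg w_ge0.
have /(_ f0 isT) /eqP := psumr_eq0P pos E.
by rewrite mulf_eq0 gt_eqF //= f0j subr0 oner_eq0.
Qed.

Lemma noninjective_misses (f : selfmap n) a b :
  a != b -> f a = f b -> exists c, forall i, f i != c.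
Proof.
move=> ab fab; apply: contrapT => /forallNP hit.
have fT : [set f i | i : 'I_n]%SET = [set: 'I_n]%SET.
  apply/setP => c; rewrite inE; apply/imsetP.
  have /existsNP[i /negP] := hit c.
  by rewrite negbK => /eqP <-; exists i.
have /imset_injP/(_ a b isT isT fab) /eqP : #|[set f i | i : 'I_n]%SET| == #|'I_n|.
  by rewrite fT cardsT.
by rewrite (negPf ab).
Qed.

Lemma fibre_eq0 (f : selfmap n) j : (forall i, f i != j) -> #|fibre f j| = 0%N.
Proof. by move=> H; apply: eq_card0 => i; rewrite inE (negPf (H i)). Qed.

(** Suppose that f0 identifies a and b. As the composition of two maps has rank at
    least n - 1, any point missed by one map of positive weight lies in any pair
    identified by another; in particular, one may assume that f0 misses a.
    Outside A = {a, b} no point is ever missed, hence each fibre there is a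
    singleton (fibre_eq1). Since f0 misses a, some f1 takes the value a twice
    (fibre_ge2); it misses a point, which can only be b. As a and b are
    both missed, every map that identifies two points identifies exactly a
    and b, and the common value has a fibre of two points, so it lies in A. An
    injective f also sends a into A, because the three-fold composition
    f0 o f o f0 has rank at least n - 1 and f o f0 misses f a. So the image of a
    is almost surely in A, while it is uniform on at least three points. *)
Lemma no_corank1 : (2 < n)%N ->
  (forall f g h, 0 < w f -> 0 < w g -> 0 < w h ->
     (n.-1 <= #|[set f (g (h i)) | i : 'I_n]%SET|)%N) ->
  forall f, 0 < w f -> injective f.
Proof.
move=> n3 rk3 f0 w0 a b fab; apply/eqP; apply/negPn/negP => ab.
(* Precomposing with f0 only shrinks the image. *)
have rk2 f g : 0 < w f -> 0 < w g -> (n.-1 <= #|[set f (g i) | i : 'I_n]%SET|)%N.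
  move=> wf wg; apply: leq_trans (rk3 _ _ _ wf wg w0) _.
  apply/subset_leq_card/fintype.subsetP => _ /imsetP[i _ ->].
  by apply/imsetP; exists (f0 i).
have [c f0c] := noninjective_misses ab fab.
wlog ca : a b ab fab / c = a.
  move=> W; have /orP[/eqP|/eqP] := missing_in_kernel (rk2 _ _ w0 w0) f0c ab fab.
    exact: W ab fab.
  by apply: (W b a) => //; rewrite eq_sym.
move: f0c; rewrite {c}ca => f0a.
have ker_a f x y : 0 < w f -> x != y -> f x = f y -> (a == x) || (a == y).
  by move=> wf; apply: missing_in_kernel (rk2 _ _ wf w0) _.
have missed f j : 0 < w f -> (forall i, f i != j) -> (j == a) || (j == b).
  by move=> wf fj; apply: missing_in_kernel (rk2 _ _ w0 wf) _ _ _.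
have fib1 f j : j != a -> j != b -> 0 < w f -> #|fibre f j| = 1%N.
  move=> ja jb; apply: fibre_eq1 => g wg; rewrite lt0n; apply/negP => /eqP g0.
  have : (j == a) || (j == b).
    apply: missed wg _ => i; apply/negP => gi.
    by move/card0_eq: g0 => /(_ i); rewrite inE gi.
  by rewrite (negPf ja) (negPf jb).
have [f1 w1 /card_gt1P[x [y [+ + xy]]]] := fibre_ge2 w0 (fibre_eq0 f0a).
rewrite !inE => /eqP f1x /eqP f1y.
have f1b : forall i, f1 i != b.
  have [|c f1c] := noninjective_misses xy (f := f1); first by rewrite f1x.
  have /orP[/eqP ca|/eqP <- //] := missed _ _ w1 f1c.
  by move: (f1c x); rewrite f1x ca eqxx.
have ker_b f z t : 0 < w f -> z != t -> f z = f t -> (b == z) || (b == t).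
  by move=> wf; apply: missing_in_kernel (rk2 _ _ wf w1) _.
have fa f : 0 < w f -> (f a == a) || (f a == b).
  move=> wf; have [e|ne] := eqVneq (f a) (f b).
    apply/negPn/negP; rewrite negb_or => /andP[na nb].
    suff : (1 < #|fibre f (f a)|)%N by rewrite fib1.
    by apply/card_gt1P; exists a, b; rewrite !inE e eqxx.
  have finj : injective f.
    move=> z t fzt; apply/eqP/negPn/negP => zt.
    move: (ker_a _ _ _ wf zt fzt) (ker_b _ _ _ wf zt fzt) ne ab.
    case/orP => /eqP -> /orP[] /eqP ->; rewrite ?fzt ?eqxx //.
  apply: (@missing_in_kernel _ f0 (f \o f0)) ab fab; first exact: rk3.
  by move=> i /=; rewrite (inj_eq finj).
(* A point outside A is never the image of a, against uniformity. *)
have [j /andP[ja jb]] : exists j, (j != a) && (j != b).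
  have : (0 < #|~: [set a; b]%SET|)%N.
    by rewrite cardsCs finset.setCK card_ord cards2 ab subn_gt0.
  by case/card_gt0P => j; rewrite !inE negb_or; exists j.
have := w_marginal a j; rewrite big1 => [/esym/eqP|f _].
  by rewrite invr_eq0 pnatr_eq0 -leqn0 leqNgt n_gt0.
have [->|wf] := eqVneq (w f) 0; first by rewrite mul0r.
have := fa f; rewrite lt_neqAle eq_sym wf w_ge0 => /(_ isT).
by case/orP => /eqP ->; rewrite eq_sym ?(negPf ja) ?(negPf jb) mulr0.
Qed.
End UniformWeights.

(** * Product laws and the coalescence number *)

Local Open Scope classical_set_scope.
Local Open Scope ring_scope.

Definition weight (R : realType) n (mu : probability (selfmap n) R) f : R :=
  fine (mu [set f]).

Section Weights.
Variables (R : realType) (n : nat) (mu : probability (selfmap n) R).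

Lemma weight_ge0 f : 0 <= weight mu f.
Proof. exact: fine_ge0. Qed.

Lemma supp_weight f : supp mu f <-> 0 < weight mu f.
Proof.
by rewrite /supp /= /weight -lte_fin fineK // fin_num_measure.
Qed.

Lemma mu_sum_weight (p : pred (selfmap n)) :
  mu [set f | p f] = (\sum_(f | p f) weight mu f)%:E.
Proof.
pose r := [seq f <- index_enum (selfmap n) | p f].
have pr : [set f | p f] = [set` r].
  by apply/seteqP; split=> f; rewrite /= mem_filter mem_index_enum andbT.
rewrite pr -[X in mu X]image_id -bigcup_imset1 measure_fin_bigcup //; last first.
  by move=> f g _ _ [h [/= -> ->]].
rewrite -fsbig_seq ?filter_uniq ?index_enum_uniq // big_filter -sumEFin.
by apply: eq_bigr => f _; rewrite fineK // fin_num_measure.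
Qed.
End Weights.

Definition cylinder n (N : nat) (A : nat -> set (selfmap n)) : set (mapseq n) :=
  [set F : mapseq n | forall s, (s < N)%N -> A s (F s)].

Lemma measurable_coordinate n s (A : set (selfmap n)) :
  measurable [set F : mapseq n | A (F s)].
Proof.
apply: sub_sigma_algebra; exists s => //; exists A => //.
by rewrite setTI.
Qed.

Lemma measurable_cylinder n N (A : nat -> set (selfmap n)) :
  measurable (cylinder N A).
Proof.
have -> : cylinder N A = \bigcap_(s in [set s | (s < N)%N]) [set F : mapseq n | A s (F s)].
  by [].
by apply: bigcap_measurableType => s _; exact: measurable_coordinate.
Qed.

Lemma cylinderI n : setI_closed [set @cylinder n N A | N in setT & A in setT].
Proof.
move=> _ _ [N _ [A _ <-]] [N' _ [A' _ <-]].
exists (maxn N N') => //.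
exists (fun s => [set f | ((s < N)%N -> A s f) /\ ((s < N')%N -> A' s f)]) => //.
apply/seteqP; split=> F /=.
  move=> H; split=> s sN.
    by apply: (H s _).1; rewrite // leq_max sN.
  by apply: (H s _).2; rewrite // leq_max sN orbT.
by move=> [H H'] s _; split => ?; [exact: H|exact: H'].
Qed.

(** Unlike the events that involve a single coordinate, the cylinders form a
    pi-system, as the uniqueness theorem for measures requires. *)
Lemma measurable_mapseqE n :
  @measurable _ (mapseq n) = <<s [set @cylinder n N A | N in setT & A in setT] >>.
Proof.
apply/seteqP; split.
  apply: smallest_sub; first exact: smallest_sigma_algebra.
  move=> _ [s _ [A _ <-]]; apply: sub_sigma_algebra.
  exists s.+1 => //; exists (fun t => if t == s then A else setT) => //.
  rewrite setTI; apply/seteqP; split=> F /=.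
    by move=> /(_ s (leqnn _)); rewrite eqxx.
  by move=> AF t _; case: eqP => // ->.
apply: smallest_sub; first exact: sigma_algebra_measurable.
by move=> _ [N _ [A _ <-]]; exact: measurable_cylinder.
Qed.

Section ProductLaw.
Variables (R : realType) (n : nat) (mu : probability (selfmap n) R).

Lemma product_law_unique (M M' : probability (mapseq n) R) :
  is_product_law mu M -> is_product_law mu M' ->
  forall X, measurable X -> M X = M' X.
Proof.
move=> HM HM' X mX.
apply: (measure_unique _ (fun=> setT) (@measurable_mapseqE n) (@cylinderI n)) => //.
- move=> _; exists 0%N => //; exists (fun=> setT) => //.
  by apply/seteqP.
- by apply/seteqP; split => // F _; exists 0%N.
- by move=> _ [N _ [A _ <-]]; rewrite [LHS]HM [RHS]HM'.
- by move=> _; apply: le_lt_trans (probability_le1 _ _) (ltry _).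
Qed.

Lemma ae_product_law (M M' : probability (mapseq n) R) (P : mapseq n -> Prop) :
  is_product_law mu M -> is_product_law mu M' ->
  {ae M, forall F, P F} -> {ae M', forall F, P F}.
Proof.
move=> HM HM' [X [mX X0 PX]]; exists X; split => //.
by rewrite -X0; apply: product_law_unique.
Qed.

Lemma ae_ex (M : probability (mapseq n) R) (P : mapseq n -> Prop) :
  {ae M, forall F, P F} -> exists F, P F.
Proof.
move=> [X [mX X0 PX]]; apply: contrapT => /forallNP nP.
have XT : X = setT by apply/seteqP; split => // F _; exact/PX/nP.
by move/eqP: X0; rewrite XT probability_setT onee_eq0.
Qed.

(** Two product laws of the same measure agree, so that both almost sure values
    are attained at a common sequence. *)
Lemma coalescence_number_unique k k' :
  is_coalescence_number mu k -> is_coalescence_number mu k' -> k = k'.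
Proof.
move=> [M [HM kM]] [M' [HM' /(ae_product_law HM' HM) kM']].
by have [F [<- <-]] := ae_ex (filterI kM kM').
Qed.

Lemma ae_supp (M : probability (mapseq n) R) : is_product_law mu M ->
  {ae M, forall F : mapseq n, forall s, supp mu (F s)}.
Proof.
move=> HM; apply: ae_foralln => s.
exists (cylinder s.+1 (fun t => if t == s then ~` supp mu else setT)).
split; first exact: measurable_cylinder.
- rewrite [LHS]HM (bigD1 ord_max) //= eqxx.
  have -> : ~` supp mu = [set f | ~~ (0 < weight mu f)].
    by apply/seteqP; split=> f; [move=> nf; apply/negP|move=> /negP nf] => /supp_weight.
  rewrite [X in (X * _)%E]mu_sum_weight big1 ?mul0e // => f.
  by rewrite lt_neqAle weight_ge0 andbT negbK => /eqP.
- by move=> F /= nF t _; case: eqP => // ->.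
Qed.

(** The first three maps are h, g, f with positive probability, and then the
    number of classes is at most the rank of f o g o h (nb_classes_le). *)
Lemma coalescence_le_word k f g h : is_coalescence_number mu k ->
  supp mu f -> supp mu g -> supp mu h ->
  (k <= #|[set f (g (h i)) | i : 'I_n]%SET|)%N.
Proof.
move=> [M [HM [X [mX X0 kX]]]] sf sg sh.
(* The default value f of nth serves as the third letter. *)
pose A s : set (selfmap n) := [set nth f [:: h; g] s].
rewrite leqNgt; apply/negP => lt_k.
have : (0 < M (cylinder 3 A))%E.
  rewrite [X in (_ < X)%E]HM !big_ord_recl big_ord0 mule1.
  by rewrite !mule_gt0.
rewrite ltNge -X0 => /negP[]; apply: le_measure; rewrite ?inE //.
  exact: measurable_cylinder.
move=> F /= AF; apply: kX => /= kF; move: lt_k; rewrite -kF ltnNge => /negP[].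
apply: leq_trans (nb_classes_le F (isT : (0 < 3)%N)) _.
by rewrite /= (AF 0%N isT) (AF 1%N isT) (AF 2%N isT).
Qed.

Lemma coalescence_injective k : is_coalescence_number mu k ->
  (forall f, supp mu f -> injective f) -> k = n.
Proof.
move=> [M [HM kM]] inj; have [F [Fs <-]] := ae_ex (filterI (ae_supp HM) kM).
by apply: nb_classes_injective => s; apply/inj/Fs.
Qed.
End ProductLaw.

(** * Independent uniform digits *)

Section Digits.
Variables (R : realType) (b' : nat).
Notation b := b'.+1.
Notation truncn := Num.truncn.

(** The b-adic interval of level N and index q: the points x >= 0 such that the
    integral part of x b^N is q. *)
Definition cell (N q : nat) : set R :=
  [set` `[(q%:R / b%:R ^+ N), (q.+1%:R / b%:R ^+ N)[ ].

(** The digit of index s, counted from 0, after the point in base b. *)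
Definition digit (s : nat) (x : R) : 'I_b :=
  Ordinal (ltn_pmod (truncn (x * b%:R ^+ s.+1)) (ltn0Sn b')).

Lemma base_gt0 N : (0 : R) < b%:R ^+ N.
Proof. by rewrite exprn_gt0 // ltr0n. Qed.

Lemma cellE N q x : cell N q x <-> 0 <= x /\ truncn (x * b%:R ^+ N) = q.
Proof.
have bN := base_gt0 N; rewrite /cell /= in_itv /= ler_pdivrMr // ltr_pdivlMr //.
split=> [/andP[lo hi]|[x0 <-]].
  by split; [rewrite -(pmulr_lge0 _ bN) (le_trans _ lo)|apply: truncn_def; rewrite lo].
by rewrite truncn_itv // mulr_ge0 // ltW.
Qed.

(** Dropping the last base b digit of the integral part of y b leaves the integral
    part of y. *)
Lemma truncn_divn (y : R) : 0 <= y -> (truncn (y * b%:R) %/ b)%N = truncn y.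
Proof.
move=> y0; have b0 : (0 : R) < b%:R by rewrite ltr0n.
apply/esym/truncn_def; set t := truncn _.
have /andP[lo hi] := truncn_itv (mulr_ge0 y0 (ltW b0)).
rewrite -(ler_pM2r b0) -[X in _ && X](ltr_pM2r b0) -!natrM; apply/andP; split.
  by apply: le_trans lo; rewrite ler_nat leq_divM.
by apply: lt_le_trans hi _; rewrite ler_nat ltn_ceil.
Qed.

(** The next digit tells which of its b subintervals of level N + 1 contains x. *)
Lemma cell_digit N q (a : 'I_b) x :
  (cell N q x /\ digit N x = a) <-> cell N.+1 (q * b + a) x.
Proof.
have dE : digit N x = a <-> (truncn (x * b%:R ^+ N * b%:R) %% b)%N = a.
  rewrite -mulrA -exprSr; split=> [<- //|e]; exact: val_inj.
rewrite !cellE dE exprSr mulrA.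
set y := x * _; have y0 : 0 <= x -> 0 <= y.
  by move=> x0; rewrite mulr_ge0 // ltW // base_gt0.
split=> [[[x0 <-] <-]|[x0 e]]; split => //.
- by rewrite -(truncn_divn (y0 x0)) -divn_eq.
- by split=> //; rewrite -(truncn_divn (y0 x0)) e divnMDl // divn_small ?addn0.
- by rewrite e modnMDl modn_small.
Qed.

Lemma measurable_cell N q : measurable (cell N q).
Proof. exact: measurable_itv. Qed.

Lemma measurable_truncn_eq (c : R) q : 0 < c ->
  measurable [set x : R | truncn (x * c) = q].
Proof.
move=> c0; have le_meas r : measurable [set x : R | (truncn (x * c) <= r)%N].
  have -> : [set x : R | (truncn (x * c) <= r)%N] = [set` `]-oo, (r.+1%:R / c)[ ].
    by apply/seteqP; split=> x; rewrite /= in_itv /= truncn_le_nat ltr_pdivlMr.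
  exact: measurable_itv.
case: q => [|q].
  have -> // : [set x : R | truncn (x * c) = 0%N] = [set x : R | (truncn (x * c) <= 0)%N].
  by apply/seteqP; split=> x /=; rewrite leqn0 => /eqP.
have -> : [set x : R | truncn (x * c) = q.+1] =
    [set x : R | (truncn (x * c) <= q.+1)%N] `\` [set x : R | (truncn (x * c) <= q)%N].
  apply/seteqP; split=> x /=; first by move=> ->; split=> //; rewrite ltnn.
  by move=> [lo hi]; apply/eqP; rewrite eqn_leq lo ltnNge; apply/negP.
exact: measurableD.
Qed.

Lemma measurable_digit s (D : set 'I_b) : measurable [set x : R | D (digit s x)].
Proof.
have -> : [set x : R | D (digit s x)] =
    \bigcup_(q in [set q | D (Ordinal (ltn_pmod q (ltn0Sn b')))])
      [set x : R | truncn (x * b%:R ^+ s.+1) = q].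
  apply/seteqP; split=> x /=; first by exists (truncn (x * b%:R ^+ s.+1)).
  by move=> [q /= + e]; rewrite -e.
by apply: bigcup_measurable => q _; exact: measurable_truncn_eq (base_gt0 _).
Qed.

Lemma lebesgue_cell N q :
  lebesgue_measure (cell N q) = (b%:R ^- N)%:E.
Proof.
have bN := base_gt0 N.
rewrite lebesgue_measure_itv /= lte_fin ltr_pM2r ?invr_gt0 // ltr_nat ltnSn.
by rewrite -EFinD -mulrBl -natrB // subSnn mul1r.
Qed.

Definition digit_event N k (D : nat -> {set 'I_b}) : set R :=
  [set x | forall s, (s < k)%N -> digit (N + s) x \in D s].

Lemma measurable_digit_event N k D : measurable (digit_event N k D).
Proof.
have -> : digit_event N k D =
    \bigcap_(s in [set s | (s < k)%N]) [set x | (fun a => a \in D s) (digit (N + s) x)].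
  by [].
by apply: bigcap_measurableType => s _;
  exact: (measurable_digit (N + s) (fun a => a \in D s)).
Qed.

(** Independence and uniformity of the digits, conditionally on the first N of
    them. The induction on k splits the cell along the digit of index N
    (cell_digit), which is why N and q are general. *)
Lemma lebesgue_digit_event k N q (D : nat -> {set 'I_b}) :
  lebesgue_measure (cell N q `&` digit_event N k D) =
  (b%:R ^- N * \prod_(s < k) (#|D s|%:R / b%:R))%:E.
Proof.
elim: k N q D => [|k IH] N q D.
  rewrite big_ord0 mulr1 -(lebesgue_cell N q); congr lebesgue_measure.
  by apply/seteqP; split=> x // [].
have -> : cell N q `&` digit_event N k.+1 D = \big[setU/set0]_(a < b | a \in D 0%N)
    (cell N.+1 (q * b + a) `&` digit_event N.+1 k (fun s => D s.+1)).
  rewrite -(bigcup_pred (mem (D 0%N))); apply/seteqP; split=> x /=.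
    move=> [qx Dx]; exists (digit N x).
      by have := Dx 0%N isT; rewrite addn0.
    split; first exact/cell_digit.
    by move=> s sk; rewrite addSnnS; apply: Dx.
  move=> [a /= Da [/cell_digit[qx ax] Dx]]; split=> // -[|s] sk.
    by rewrite addn0 ax.
  by rewrite -addSnnS; apply: Dx.
rewrite measure_bigsetU_ord //; last 2 first.
- move=> a; apply: measurableI; first exact: measurable_cell.
  exact: measurable_digit_event.
- move=> a a' _ _ [x [[/cell_digit[_ ax] _] [/cell_digit[_ ax'] _]]].
  by rewrite -ax -ax'.
transitivity (\sum_(a in D 0%N)
    (b%:R ^- N.+1 * \prod_(s < k) (#|D s.+1|%:R / b%:R : R))%:E)%E.
  by apply: eq_bigr => a _; exact: IH.
rewrite sumEFin sumr_const big_ord_recl exprSr invfM; congr EFin.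
rewrite -[_ *+ #|_|]mulr_natr -!mulrA; congr (_ * _).
by rewrite [in RHS]mulrC -!mulrA.
Qed.
End Digits.

Section UnitInterval.
Variable R : realType.

Definition unit_interval_law := mrestr (@lebesgue_measure R) (measurable_itv `[0, 1[%R).
HB.instance Definition _ := Measure.on unit_interval_law.

Lemma unit_interval_lawT : unit_interval_law setT = 1%E.
Proof.
by rewrite /unit_interval_law /mrestr setTI lebesgue_measure_itv /= lte_fin ltr01 oppr0 adde0.
Qed.

HB.instance Definition _ :=
  @Measure_isProbability.Build _ _ R unit_interval_law unit_interval_lawT.

Variables (m b' : nat) (G : 'I_b'.+1 -> selfmap m).

(** Independent uniform indices are read off as the digits of a uniform point of
    the unit interval, and G turns indices into maps. *)
Definition digit_maps (x : measurableTypeR R) : mapseq m := fun s => G (digit b' s x).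
Definition first_map (x : measurableTypeR R) : selfmap m := G (digit b' 0 x).

Lemma measurable_first_map : measurable_fun setT first_map.
Proof.
move=> _ A _; rewrite setTI; exact: (measurable_digit 0 (fun a => A (G a))).
Qed.

Lemma measurable_digit_maps : measurable_fun setT digit_maps.
Proof.
refine (@measurability _ _ _ _ setT digit_maps (@coordinate_events m) erefl _).
move=> _ [_ [s _ [A _ <-]] <-]; rewrite !setTI.
exact: (measurable_digit s (fun a => A (G a))).
Qed.

HB.instance Definition _ := isMeasurableFun.Build _ _ _ _ first_map measurable_first_map.
HB.instance Definition _ := isMeasurableFun.Build _ _ _ _ digit_maps measurable_digit_maps.

Definition pushed_uniform : probability (selfmap m) R :=
  distribution unit_interval_law first_map.
Definition pushed_uniform_seq : probability (mapseq m) R :=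
  distribution unit_interval_law digit_maps.

Definition preim_set (A : set (selfmap m)) : {set 'I_b'.+1} :=
  finset (fun a => `[< A (G a) >]).

Lemma pushed_uniform_seqE N (A : nat -> set (selfmap m)) :
  pushed_uniform_seq (cylinder N A) =
  (\prod_(s < N) (#|preim_set (A s)|%:R / b'.+1%:R))%:E.
Proof.
have := @lebesgue_digit_event R b' N 0 0 (fun s => preim_set (A s)).
rewrite expr0 invr1 mul1r => <-.
rewrite /pushed_uniform_seq /distribution /pushforward /= /unit_interval_law /mrestr /=.
congr lebesgue_measure; rewrite setIC; congr (_ `&` _).
  by rewrite /cell expr0 !divr1.
apply/seteqP; split=> x H s sN; have := H s sN; rewrite /= inE.
  by move=> As; exact/asboolP.
by move=> /asboolP.
Qed.

Lemma pushed_uniformE A :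
  pushed_uniform A = (#|preim_set A|%:R / b'.+1%:R)%:E.
Proof.
have := pushed_uniform_seqE 1 (fun=> A).
rewrite big_ord1 => <-; congr (unit_interval_law _).
apply/seteqP; split=> x.
  by move=> Ax [|s].
by move=> /(_ 0%N isT).
Qed.

Lemma pushed_uniform_product_law : is_product_law pushed_uniform pushed_uniform_seq.
Proof.
move=> N A; rewrite [LHS]pushed_uniform_seqE.
under [RHS]eq_bigr do rewrite pushed_uniformE.
by rewrite prodEFin.
Qed.
End UnitInterval.

(** * Consequences of a uniform transition matrix *)

Section Uniform.
Variables (R : realType) (n : nat) (mu : probability (selfmap n) R).
Hypothesis n_gt0 : (0 < n)%N.
Hypothesis mu_uniform : consistent (uniform_mx R n) mu.

Lemma weight_marginal i j : \sum_f weight mu f * (f i == j)%:R = n%:R^-1.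
Proof.
have := mu_uniform i j; rewrite mxE.
have -> : [set f : selfmap n | f i = j] = [set f | f i == j].
  by apply/seteqP; split=> f /eqP.
rewrite mu_sum_weight => -[->]; rewrite [RHS]big_mkcond; apply: eq_bigr => f _.
by case: eqP => _; rewrite ?mulr1 ?mulr0.
Qed.

(** Choose a point x_r in each block, and fix a block B_q. Since the blocks are
    permuted, exactly one of the x_r is mapped into B_q. Each of them is mapped
    into B_q with probability |B_q| / n, so l |B_q| / n = 1. *)
Lemma block_dvdn l (B : 'I_l -> {set 'I_n}) : (0 < l)%N ->
  is_partition_family B ->
  (forall f, supp mu f -> exists p : {perm 'I_l},
     forall r, (f : {ffun 'I_n -> 'I_n}) @: B r \subset B (p r)) ->
  (l %| n)%N.
Proof.
move=> l_gt0 [Binj /and3P[_ /finset.trivIsetP Bdis Bn0]] Bperm.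
have /fin_all_exists[x xB] r : exists x, x \in B r.
  by apply/set0Pn; apply: contraNneq Bn0 => <-; apply: imset_f.
have disB r q y : y \in B r -> y \in B q -> r = q.
  move=> yr yq; apply/eqP/negPn/negP => rq.
  have := Bdis _ _ (imset_f B (isT : r \in predT)) (imset_f B (isT : q \in predT)).
  by rewrite (inj_eq Binj) => /(_ rq) /disjointFr /(_ yr); rewrite yq.
pose q : 'I_l := Ordinal l_gt0.
have E : l%:R * (#|B q|%:R / n%:R) = 1 :> R.
  rewrite -[RHS](sum_weights n_gt0 weight_marginal).
  transitivity (\sum_(r < l) \sum_(j in B q) \sum_f weight mu f * (f (x r) == j)%:R).
    transitivity (\sum_(r < l) \sum_(j in B q) (n%:R^-1 : R)).
      by rewrite !sumr_const card_ord !mulr_natl.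
    by apply: eq_bigr => r _; apply: eq_bigr => j _; rewrite weight_marginal.
  under eq_bigr do rewrite exchange_big /=.
  rewrite exchange_big /=; apply: eq_bigr => f _.
  under eq_bigr do rewrite -mulr_sumr.
  rewrite -mulr_sumr; have [->|wf] := eqVneq (weight mu f) 0; first by rewrite mul0r.
  have [|p pB] := Bperm f; first by apply/supp_weight; rewrite lt_neqAle eq_sym wf weight_ge0.
  have fB r : f (x r) \in B (p r).
    by apply: (fintype.subsetP (pB r)); apply: imset_f.
  rewrite -[RHS]mulr1; congr (_ * _).
  (* The only block sent into B_q is the one of index p^-1 q. *)
  rewrite (bigD1 ((p^-1)%g q)) //= [X in _ + X]big1 => [|r rq].
    rewrite addr0 (bigD1 (f (x ((p^-1)%g q)))) /=; last first.
      by have := fB ((p^-1)%g q); rewrite permKV.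
    by rewrite eqxx big1 ?addr0 // => j /andP[_ /negPf]; rewrite eq_sym => ->.
  apply: big1 => j jq; case: eqP => // fj; case/eqP: rq.
  by rewrite -(_ : p r = q) ?permK //; apply: (disB _ _ _ (fB r)); rewrite fj.
apply/dvdnP; exists #|B q|; apply/eqP.
rewrite -(eqr_nat R) mulnC natrM; apply/eqP.
have nR : (n%:R : R) != 0 by rewrite pnatr_eq0 -lt0n.
by move: E => /(congr1 ( *%R^~ n%:R)) /=; rewrite mul1r mulrA divfK.
Qed.

Lemma corank1_not_coalescence : (2 < n)%N -> ~ is_coalescence_number mu n.-1.
Proof.
move=> n3 kmu.
have inj : forall f, supp mu f -> injective f.
  move=> f /supp_weight; apply: (no_corank1 n_gt0 (weight_ge0 mu) weight_marginal n3).
  by move=> g h k /supp_weight sg /supp_weight sh /supp_weight sk;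
    exact: coalescence_le_word kmu sg sh sk.
have := coalescence_injective kmu inj.
by case: n n_gt0 => //= m _ /eqP; rewrite (ltn_eqF (ltnSn m)).
Qed.
End Uniform.

(** * Block measures from shifts of residues *)

Section ShiftMaps.
Variables (R : realType) (n' l : nat).
Notation n := n'.+1.
Hypotheses (l_dvd : (l %| n)%N) (l_gt0 : (0 < l)%N).

(** Write a point of S as c + l d with c < l. The map attached to a = c + l d
    shifts all residues modulo l by c and replaces the quotients by d: it permutes
    the residue classes and is constant on each of them, and for a fixed y its
    value at y runs through S as a does. *)
Definition shift_map (a : 'I_n) : selfmap n :=
  [ffun y : 'I_n => inord ((a + y) %% l + a %/ l * l)].

Lemma shift_mapE (a y : 'I_n) : shift_map a y = ((a + y) %% l + a %/ l * l)%N :> nat.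
Proof.
rewrite ffunE inordK //; have /dvdnP[m nE] := l_dvd; rewrite [X in (_ < X)%N]nE.
apply: (@leq_trans (l + a %/ l * l)); first by rewrite ltn_add2r ltn_pmod.
by rewrite -mulSn leq_mul2r ltn_divLR // -nE ltn_ord orbT.
Qed.

Lemma shift_map_mod (a y : 'I_n) : shift_map a y = a + y %[mod l].
Proof. by rewrite shift_mapE addnC modnMDl modn_mod. Qed.

Lemma shift_map_inj (y : 'I_n) : injective (shift_map ^~ y).
Proof.
move=> a a' e; apply: val_inj; rewrite /= (divn_eq a l) (divn_eq a' l).
have /eqP := shift_map_mod a y; rewrite e shift_map_mod eqn_modDr => /eqP ->.
congr (_ * _ + _)%N; have := congr1 (fun z : 'I_n => z %/ l)%N e.
by rewrite !shift_mapE ![(_ %% _ + _)%N]addnC !divnMDl //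
  ![(_ %% _ %/ _)%N]divn_small ?ltn_pmod // !addn0.
Qed.

Definition residue (y : 'I_n) : 'I_l := Ordinal (ltn_pmod y l_gt0).

Lemma residue_surj r : exists y, residue y = r.
Proof.
have rn : (r < n)%N by apply: leq_trans (ltn_ord r) (dvdn_leq _ l_dvd).
by exists (Ordinal rn); apply: val_inj; rewrite /= modn_small.
Qed.

Lemma residueE y z : residue y = residue z <-> y = z %[mod l].
Proof. by split=> [/(congr1 val)|e]; last exact: val_inj. Qed.

(** Points with the same residue merge at the first step, and points with
    distinct residues keep distinct residues for ever. *)
Lemma coalesce_shift (F : nat -> selfmap n) :
  (forall s, exists a, F s = shift_map a) ->
  forall i j, coalesce F i j <-> residue i = residue j.
Proof.
move=> FS i j; rewrite residueE; split=> [/asboolP[t [_ e]]|e].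
  have : forward F t i = forward F t j %[mod l] by rewrite e.
  elim: t {e} => //= t IH; have [a ->] := FS t.
  by rewrite !shift_map_mod => /eqP; rewrite eqn_modDl => /eqP /IH.
apply/asboolP; exists 1%N; split=> //=; have [a ->] := FS 0%N.
apply: val_inj; rewrite /= !shift_mapE; congr (_ + _)%N.
by apply/eqP; rewrite eqn_modDl e.
Qed.

Lemma nb_classes_shift (F : nat -> selfmap n) :
  (forall s, exists a, F s = shift_map a) -> nb_classes F = l.
Proof.
move=> /coalesce_shift /nb_classesE ->.
have -> : [set residue i | i : 'I_n]%SET = [set: 'I_l]%SET.
  apply/setP => r; rewrite inE; apply/imsetP.
  by have [y <-] := residue_surj r; exists y.
by rewrite cardsT card_ord.
Qed.

Definition shift_law : probability (selfmap n) R := pushed_uniform R shift_map.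

Lemma shift_lawE A :
  shift_law A = (#|preim_set shift_map A|%:R / n%:R)%:E.
Proof. exact: pushed_uniformE. Qed.

Lemma supp_shift f : supp shift_law f -> exists a, f = shift_map a.
Proof.
rewrite /supp /mkset shift_lawE lte_fin => f_gt0.
have /card_gt0P[a] : (0 < #|preim_set shift_map [set f]|)%N.
  by rewrite lt0n; apply: contraTneq f_gt0 => ->; rewrite mul0r ltxx.
by rewrite inE => /asboolP <-; exists a.
Qed.

Lemma consistent_shift : consistent (uniform_mx R n) shift_law.
Proof.
move=> i j; rewrite mxE [RHS]shift_lawE.
have -> : preim_set shift_map [set f : selfmap n | f i = j] = (shift_map ^~ i) @^-1: [set j]%SET.
  by apply/setP => a; rewrite !inE; apply/asboolP/eqP.
rewrite on_card_preimset ?cards1 ?mul1r //.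
exact/onW_bij/injF_bij/shift_map_inj.
Qed.

Lemma coalescence_shift : is_coalescence_number shift_law l.
Proof.
exists (pushed_uniform_seq R shift_map); split; first exact: pushed_uniform_product_law.
apply: filterS (ae_supp (@pushed_uniform_product_law _ _ _ shift_map)) => F FS.
by apply: nb_classes_shift => s; apply: supp_shift.
Qed.

Definition residue_class (r : 'I_l) : {set 'I_n} := [set y | residue y == r]%SET.

Lemma residue_classP : is_partition_family residue_class.
Proof.
split=> [r r' e|].
  have [y yr] := residue_surj r; move/setP: e => /(_ y); rewrite !inE yr eqxx.
  by move=> /esym/eqP.
have -> : [set residue_class r | r : 'I_l]%SET = preim_partition residue [set: 'I_n]%SET.
  apply/setP => C; apply/imsetP/imsetP => -[].
    move=> r _ ->; have [y <-] := residue_surj r; exists y => //.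
    by apply/setP => z; rewrite !inE eq_sym.
  move=> y _ ->; exists (residue y) => //.
  by apply/setP => z; rewrite !inE eq_sym.
exact: preim_partitionP.
Qed.

Lemma shift_block f : supp shift_law f -> exists! p : {perm 'I_l},
  forall r, (f : {ffun 'I_n -> 'I_n}) @: residue_class r \subset residue_class (p r).
Proof.
move=> /supp_shift[a ->].
pose rot (r : 'I_l) : 'I_l := Ordinal (ltn_pmod (a + r) l_gt0).
have rot_inj : injective rot.
  move=> r r' /(congr1 val) /= /eqP; rewrite eqn_modDl !modn_small // => /eqP.
  exact: val_inj.
have residue_shift y : residue (shift_map a y) = rot (residue y).
  by apply: val_inj; rewrite /= shift_map_mod modnDmr.
exists (perm rot_inj); split=> [r|p pB].
  apply/fintype.subsetP => _ /imsetP[y + ->]; rewrite !inE permE => /eqP <-.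
  by rewrite residue_shift.
apply/permP => r; rewrite permE; have [y <-] := residue_surj r.
have /fintype.subsetP/(_ (shift_map a y)) := pB (residue y).
rewrite !inE residue_shift => /(_ _)/eqP; apply.
by apply: imset_f; rewrite inE.
Qed.
End ShiftMaps.

(** * The theorem *)

Theorem theorem7 (R : realType) :
  (forall n l : nat, (2 <= n)%N -> (1 <= l)%N ->
    ((exists mu : probability (selfmap n) R,
        is_block_measure (uniform_mx R n) mu /\ is_coalescence_number mu l)
     <-> (l %| n)%N))
  /\ (forall n : nat, (2 <= n)%N ->
       [set l : nat | (l %| n)%N] `<=` coalescence_numbers (uniform_mx R n))
  /\ (forall n : nat, (3 <= n)%N ->
       ~ coalescence_numbers (uniform_mx R n) (n - 1)%N).
Proof.
split; [|split].
- move=> [//|n] l _ l_gt0; split=> [[mu [[l' [B [l'_gt0 Bpart [mu_P mu_B mu_l']]]] mu_l]]|l_dvd].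
    rewrite (coalescence_number_unique mu_l mu_l').
    apply: (block_dvdn (ltn0Sn n) mu_P l'_gt0 Bpart) => f /mu_B[p [pB _]].
    by exists p.
  exists (shift_law R n l); split; last exact: coalescence_shift.
  exists l, (@residue_class n l l_gt0); split=> //; first exact: residue_classP.
  by split; [exact: consistent_shift|exact: shift_block|exact: coalescence_shift].
- move=> [//|n] _ l /= l_dvd; have l_gt0 := dvdn_gt0 (ltn0Sn n) l_dvd.
  by exists (shift_law R n l); [exact: consistent_shift|exact: coalescence_shift].
- move=> n n3 [mu mu_P]; rewrite subn1.
  by apply: corank1_not_coalescence => //; apply: leq_trans n3.
Qed.
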